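(* Let $\gamma>0$, let $F_0$ be a distribution supported on $[0,\infty)$, and let $F$ be the distribution with $$\overline F(x)=\mathbf 1(x<0)+e^{-\gamma x}\,\overline{F_0}(x)\,\mathbf 1(x\ge0),\quad x\in(-\infty,\infty).$$ If $F_0$ is a heavy-tailed distribution such that $F_0\in\mathcal{OL}$ and $$\lim_{x\to\infty}\overline{F_0}(x)\,C^*(F_0,x)=0,$$ then, for all $k\ge1$, $F^{*k}\in\mathcal{OL}$ and $$\liminf_{x\to\infty}\frac{\overline{F^{*k}}(x-t)}{\overline{F^{*k}}(x)}\ge e^{\gamma t}\quad\text{for all } t>0 .$$
   Context: $\overline V=1-V$; $V^{*k}$ is the $k$-fold convolution of $V$ with itself. $V$ is heavy-tailed if $\int e^{\lambda y}V(dy)=\infty$ for all $\lambda>0$. A distribution $V$ belongs to $\mathcal{OL}$ if for every $t>0$, $C^*(V,t)=\limsup_{x\to\infty}\overline V(x-t)/\overline V(x)<\infty$ (presupposing $\overline V(x)>0$ for all $x$). *)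

(* Defs.v *)
From HB Require Import structures.
From mathcomp Require Import all_boot all_order all_algebra.
From mathcomp Require Import all_classical all_reals all_analysis.

Set Implicit Arguments.
Unset Strict Implicit.
Unset Printing Implicit Defensive.
Import Order.TTheory GRing.Theory Num.Theory.
Import numFieldNormedType.Exports.

Local Open Scope classical_set_scope.
Local Open Scope ring_scope.

(* A distribution is a Borel probability measure on the real line. *)
Notation realdist R := (probability (measurableTypeR R) R).

Section convolution.
Context {R : realType}.
Local Notation T := (measurableTypeR R).

Definition sum_pair (z : T * T) : T := z.1 + z.2.

Lemma measurable_sum_pair : measurable_fun [set: T * T] sum_pair.
Proof.
by apply: measurable_realfun.measurable_funD.
Qed.

HB.instance Definition _ :=
  isMeasurableFun.Build _ _ _ _ sum_pair measurable_sum_pair.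

Definition convolution (P Q : realdist R) : realdist R :=
  distribution (P \x Q)%E sum_pair.

(* [iterop] gives convolution_pow V 1 = V and
   convolution_pow V 2 = convolution V V by computation; the 0-fold
   convolution is the Dirac mass at 0. *)
Definition convolution_pow (V : realdist R) (k : nat) : realdist R :=
  iterop k convolution V \d_(0 : T).

End convolution.

Section tails.
Context {R : realType}.
Implicit Type V : realdist R.

Definition tail V (x : R) : R := fine (V `]x, +oo[%classic).

Definition heavy_tailed V : Prop :=
  forall lambda : R, 0 < lambda ->
    (\int[V]_y (expR (lambda * y))%:E = +oo)%E.

Definition Cstar V (t : R) : \bar R :=
  limf_esup (fun x => (tail V (x - t) / tail V x)%:E) +oo%R.

(* Positivity of the tail is part of the class, so the real-valued quotients
   in [Cstar] have nonzero denominators. *)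
Definition class_OL V : Prop :=
  (forall x, 0 < tail V x) /\ (forall t, 0 < t -> (Cstar V t < +oo)%E).

End tails.

(* Main.v *)
Require Import Defs.
From mathcomp Require Import all_boot all_order all_algebra.
From mathcomp Require Import all_classical all_reals all_analysis.
From mathcomp Require Import measurable_realfun lra.

(** Write [S_n] for a sum of [n] independent variables of law [F], [G] for the
    law of [S_{n+1}] and [H] for the law of [S_{n+2} = Y + Z], where [Y] has
    law [F] and [Z] has law [G].

    Membership in [OL] is immediate: with one constant [C] for all real [x],
    [tail F (x - t) <= C * tail F x], as the same holds for [F0]
    ([class_OL_bound]), and integrating this over [Z] preserves it
    ([tail_walk_OL]).

    For the lower limit, [F] itself satisfies
    [expR (gamma t) * tail F x <= tail F (x - t)] as soon as [t <= x], because
    the tail of [F0] is nonincreasing. The passage from [G] to [H]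
    ([walk_exp_shift]) cuts the event [Y + Z > x] according to whether
    [Y <= x - t - B], [Z <= B], or both [Y > x - t - B] and [Z > B]. On the
    first two events one summand stays far out in its tail, so replacing [x] by
    [x - t] multiplies the probability by almost [expR (gamma t)]. It remains
    to see that the third event is negligible: for suitable large [B],
    [tail G B * tail F (x - B)] is at most [e * tail H x] for all large [x]
    ([both_large_negligible]).

    This is where the limit condition enters. It says that
    [tail F0 u * tail F0 w <= e * tail F0 (w + u)] for large [u] and then large
    [w]; monotonicity makes it uniform for [u] in bounded intervals
    ([tail_prod_bound]), and the exponential factor cancels, so [F] inherits
    it. Taking [w = x - B] and [u = B - z] and integrating over [Z] gives
    [tail F (x - B) * P (Z <= B - U, Y + Z > B) <= e * tail H x]. So
    [tail G B] has to be dominated by [P (Z <= B - U, Y + Z > B)] with a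
    constant that does not depend on [U]. If [S_{n+1}] exceeds [B], then with
    conditional probability at least one half it does not exceed [B + c], since
    by induction the tail of [G] decays exponentially; one of the [n + 1]
    summands is then large ([walk_jump]), and exchanging this summand with a
    fresh one bounded by [b] leaves the walk below [B - U] ([walk_head]). *)

Set Implicit Arguments.
Unset Strict Implicit.
Unset Printing Implicit Defensive.
Import Order.TTheory GRing.Theory Num.Theory.
Import numFieldNormedType.Exports.
Local Open Scope classical_set_scope.
Local Open Scope ring_scope.

(** * Real-valued probabilities of boolean events *)

Section prob.
Context {R : realType} {d : measure_display} {X : measurableType d}.
Variable P : probability X R.
Implicit Types b : X -> bool.

Definition prob b : R := fine (P [set x | b x]).

Lemma measurable_event b : measurable_fun setT b -> measurable [set x | b x].
Proof.
move=> mb; rewrite -[X in measurable X]setTI.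
rewrite (_ : [set x | b x] = b @^-1` [set true])//.
exact: mb.
Qed.

Lemma probE b : measurable_fun setT b -> (prob b)%:E = P [set x | b x].
Proof.
move=> mb; rewrite /prob fineK//; apply: fin_num_measure.
exact: measurable_event.
Qed.

Lemma prob_ge0 b : 0 <= prob b. Proof. exact: fine_ge0. Qed.

Lemma prob_le1 b : measurable_fun setT b -> prob b <= 1.
Proof.
by move=> mb; rewrite -lee_fin probE//; apply/probability_le1/measurable_event.
Qed.

Lemma prob_le b1 b2 : measurable_fun setT b1 -> measurable_fun setT b2 ->
  (forall x, b1 x -> b2 x) -> prob b1 <= prob b2.
Proof.
move=> m1 m2 b12; rewrite -lee_fin !probE//.
by apply: le_measure => //; rewrite inE; exact: measurable_event.
Qed.

Lemma prob_add b1 b2 : measurable_fun setT b1 -> measurable_fun setT b2 ->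
  (forall x, b1 x -> b2 x -> False) ->
  prob (fun x => b1 x || b2 x) = prob b1 + prob b2.
Proof.
move=> m1 m2 b12; apply: EFin_inj.
have m12 : measurable_fun setT (fun x => b1 x || b2 x) by exact: measurable_or.
rewrite EFinD !probE// -measureU//; first last.
- by apply/seteqP; split => x //= -[h1 h2]; exact: (b12 x).
- exact: measurable_event.
- exact: measurable_event.
by congr (P _); apply/seteqP; split=> x /=; [move/orP|move=> h; apply/orP].
Qed.

Lemma prob_or b1 b2 : measurable_fun setT b1 -> measurable_fun setT b2 ->
  prob (fun x => b1 x || b2 x) <= prob b1 + prob b2.
Proof.
move=> m1 m2.
have m2' : measurable_fun setT (fun x => ~~ b1 x && b2 x).
  by apply: measurable_and => //; exact: measurable_neg.
rewrite (_ : (fun x => b1 x || b2 x) = (fun x => b1 x || (~~ b1 x && b2 x))).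
  rewrite prob_add// => [|x -> //]; rewrite lerD2l; apply: prob_le => // x.
  by case/andP.
by apply/funext => x; case: (b1 x).
Qed.

Lemma prob_false b : (forall x, b x = false) -> prob b = 0.
Proof.
move=> b0; rewrite /prob (_ : [set x | b x] = set0) ?measure0//.
by apply/seteqP; split=> x //=; rewrite b0.
Qed.

Lemma prob_true b : (forall x, b x) -> prob b = 1.
Proof.
move=> b1; rewrite /prob (_ : [set x | b x] = setT) ?probability_setT//.
by apply/seteqP; split=> x //= _; exact: b1.
Qed.

End prob.
Arguments prob {R d X} P b.

(** The last alternatives treat functions that simplification has eta-reduced,
    which the syntactic patterns miss. *)
Ltac mevent := repeat (cbv beta; lazymatch goal with
  | |- measurable_fun _ (fun _ => _ && _) => apply: measurable_and
  | |- measurable_fun _ (fun _ => _ || _) => apply: measurable_or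
  | |- measurable_fun _ (fun _ => ~~ _) => apply: measurable_neg
  | |- measurable_fun _ (fun _ => _ < _) => apply: measurable_fun_ltr
  | |- measurable_fun _ (fun _ => _ <= _) => apply: measurable_fun_ler
  | |- measurable_fun _ (fun _ => - _) => apply: measurable_funN
  | |- measurable_fun _ (fun _ => _ + _) => apply: measurable_funD
  | |- measurable_fun _ (fun x => x.1) => exact: measurable_fst
  | |- measurable_fun _ (fun x => x.2) => exact: measurable_snd
  | |- measurable_fun _ (fun x => x) => exact: measurable_id
  | |- measurable_fun _ _ => first [exact: measurable_cst
       | exact: measurable_fst | exact: measurable_snd | exact: measurable_id
       | apply: measurable_and | apply: measurable_fun_ltr
       | apply: measurable_fun_ler | apply: measurable_funD]
  end).

(** * Events of two independent variables *)

Section joint.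
Context {R : realType}.
Local Notation T := (measurableTypeR R).
Implicit Types P Q : realdist R.

Lemma tailE P x : tail P x = prob P (fun y : T => x < y).
Proof. by rewrite /tail set_itvoy. Qed.

Definition jprob P Q (b : T -> T -> bool) : R :=
  prob (P \x Q)%E (fun z => b z.1 z.2).

Lemma conv_prob P Q (b : T -> bool) :
  prob (convolution P Q) b = jprob P Q (fun y z => b (y + z)).
Proof. by []. Qed.

Lemma measurable_secl (b : T * T -> bool) y :
  measurable_fun setT b -> measurable_fun setT (fun z => b (y, z)).
Proof. by move=> mb; exact: measurableT_comp. Qed.

Lemma measurable_secr (b : T * T -> bool) z :
  measurable_fun setT b -> measurable_fun setT (fun y => b (y, z)).
Proof. by move=> mb; exact: measurableT_comp. Qed.

Section sections.
Variables (P Q : realdist R) (b : T -> T -> bool).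
Hypothesis mb : measurable_fun setT (fun z : T * T => b z.1 z.2).

Lemma measurable_prob_secl :
  measurable_fun setT (fun y => (prob Q (b y))%:E).
Proof.
have := @measurable_fun_xsection _ _ _ _ _ Q _ (measurable_event mb).
congr (measurable_fun _ _); apply/funext => y /=; rewrite xsectionE/=.
by rewrite probE//; exact: (measurable_secl y mb).
Qed.

Lemma measurable_prob_secr :
  measurable_fun setT (fun z => (prob P (b ^~ z))%:E).
Proof.
have := @measurable_fun_ysection _ _ _ _ _ P _ (measurable_event mb).
congr (measurable_fun _ _); apply/funext => y /=; rewrite ysectionE/=.
by rewrite probE//; exact: (measurable_secr y mb).
Qed.

Lemma jprob_secl : (jprob P Q b)%:E = (\int[P]_y (prob Q (b y))%:E)%E.
Proof.
rewrite probE//=; apply: eq_integral => y _ /=; rewrite xsectionE/=.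
by rewrite probE//; exact: (measurable_secl y mb).
Qed.

Lemma jprob_secr : (jprob P Q b)%:E = (\int[Q]_z (prob P (b ^~ z))%:E)%E.
Proof.
rewrite probE//= (@product_measure_unique _ _ _ _ _ _ _ (P \x^ Q)%E)//=.
- apply: eq_integral => y _ /=; rewrite ysectionE/=.
  by rewrite probE//; exact: (measurable_secr y mb).
- by move=> A B mA mB; exact: product_measure2E.
- exact: measurable_event.
Qed.

End sections.

(** The two laws of the second variable may differ, which is how walks of
    different lengths get compared. *)
Lemma jprob_le_secl P Q1 Q2 (a : R) (b1 b2 : T -> T -> bool) :
  measurable_fun setT (fun z : T * T => b1 z.1 z.2) ->
  measurable_fun setT (fun z : T * T => b2 z.1 z.2) -> 0 <= a ->
  (forall y, a * prob Q1 (b1 y) <= prob Q2 (b2 y)) ->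
  a * jprob P Q1 b1 <= jprob P Q2 b2.
Proof.
move=> m1 m2 a0 h; rewrite -lee_fin EFinM !jprob_secl// -ge0_integralZl//=.
- apply: ge0_le_integral => //.
  + by move=> y _; rewrite mule_ge0// lee_fin ?prob_ge0.
  + by apply: measurable_funeM; exact: measurable_prob_secl.
  + exact: measurable_prob_secl.
  + by move=> y _; rewrite -EFinM lee_fin h.
- exact: (measurable_prob_secl Q1 m1).
- by move=> y _; rewrite lee_fin prob_ge0.
Qed.

(** Only nonnegative sections are compared: the others are [Q]-negligible. *)
Lemma jprob_le_secr P Q (a : R) (b1 b2 : T -> T -> bool) :
  measurable_fun setT (fun z : T * T => b1 z.1 z.2) ->
  measurable_fun setT (fun z : T * T => b2 z.1 z.2) -> 0 <= a ->
  prob Q (fun z => z < 0) = 0 ->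
  (forall z, 0 <= z -> a * prob P (b1^~ z) <= prob P (b2^~ z)) ->
  a * jprob P Q b1 <= jprob P Q b2.
Proof.
move=> m1 m2 a0 Q0 h; rewrite -lee_fin EFinM !jprob_secr// -ge0_integralZl//=.
- apply: ae_ge0_le_integral => //.
  + by move=> y _; rewrite mule_ge0// lee_fin ?prob_ge0.
  + by apply: measurable_funeM; exact: measurable_prob_secr.
  + by move=> y _; rewrite lee_fin ?prob_ge0.
  + exact: measurable_prob_secr.
  exists [set z : T | z < 0]; split.
  + by apply: measurable_event; mevent.
  + transitivity (prob Q (fun z : T => z < 0))%:E; last by rewrite Q0.
    by rewrite probE//; mevent.
  + move=> z /=; rewrite ltNge; apply: contra_notN => z0 _.
    by rewrite -EFinM lee_fin h.
- exact: (measurable_prob_secr P m1).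
- by move=> y _; rewrite lee_fin prob_ge0.
Qed.

Lemma conv_int P Q (h : T -> \bar R) : measurable_fun setT h ->
  (forall x, 0 <= h x)%E ->
  (\int[convolution P Q]_x h x = \int[P]_y \int[Q]_z h (y + z)%R)%E.
Proof.
move=> mh h0; rewrite /convolution ge0_integral_distribution//.
rewrite fubini_tonelli1//.
  by apply: measurableT_comp => //; exact: measurable_sum_pair.
by move=> x; exact: h0.
Qed.

Lemma jprob_rect P Q (p q : T -> bool) :
  measurable_fun setT p -> measurable_fun setT q ->
  jprob P Q (fun y z => p y && q z) = prob P p * prob Q q.
Proof.
move=> mp mq; apply: EFin_inj; rewrite EFinM !probE//.
  rewrite -product_measure1E//; [|exact: measurable_event..].
  by congr (_ _); apply/seteqP; split => -[y z] /= => [/andP[]|[-> ->]].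
by apply: measurable_and; exact: measurableT_comp.
Qed.
End joint.

(** * Tails and convolutions *)

Section convolution_facts.
Context {R : realType}.
Local Notation T := (measurableTypeR R).
Implicit Types P Q : realdist R.

Definition nonneg P := prob P (fun y : T => y < 0) = 0.

Lemma prob_nonneg P : nonneg P -> prob P (fun z : T => 0 <= z) = 1.
Proof.
move=> P0; apply/eqP; rewrite eq_le prob_le1 /=; last by mevent.
have : prob P (fun y : T => (y < 0) || (0 <= y)) = 1.
  by apply: prob_true => y; case: (ltP y 0).
by move=> <-; rewrite (le_trans (prob_or _ _ _))//= ?P0 ?add0r//; mevent.
Qed.

Lemma tail_ge0 P x : 0 <= tail P x. Proof. by rewrite tailE prob_ge0. Qed.
Lemma tail_le1 P x : tail P x <= 1.
Proof. by rewrite tailE prob_le1//; mevent. Qed.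
Lemma tail_le P x y : x <= y -> tail P y <= tail P x.
Proof.
by move=> xy; rewrite !tailE; apply: prob_le; [mevent..|move=> z; lra].
Qed.

Lemma jprob_le P Q (b1 b2 : T -> T -> bool) :
  measurable_fun setT (fun z : T * T => b1 z.1 z.2) ->
  measurable_fun setT (fun z : T * T => b2 z.1 z.2) ->
  (forall y z, b1 y z -> b2 y z) -> jprob P Q b1 <= jprob P Q b2.
Proof. by move=> m1 m2 b12; apply: prob_le => // -[y z]; exact: b12. Qed.

Lemma prob_gtDr P x z : prob P (fun y : T => x < y + z) = tail P (x - z).
Proof. by rewrite tailE; congr (prob _ _); apply/funext => y; rewrite ltrBlDr. Qed.

Lemma prob_gtDl P x y : prob P (fun z : T => x < y + z) = tail P (x - y).
Proof. by rewrite tailE; congr (prob _ _); apply/funext => z; rewrite ltrBlDl. Qed.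

Lemma jprob_add P Q (b1 b2 : T -> T -> bool) :
  measurable_fun setT (fun z : T * T => b1 z.1 z.2) ->
  measurable_fun setT (fun z : T * T => b2 z.1 z.2) ->
  (forall y z, b1 y z -> b2 y z -> False) ->
  jprob P Q (fun y z => b1 y z || b2 y z) = jprob P Q b1 + jprob P Q b2.
Proof. by move=> m1 m2 b12; rewrite /jprob prob_add// => -[y z]; exact: b12. Qed.

Lemma jprob_or P Q (b1 b2 : T -> T -> bool) :
  measurable_fun setT (fun z : T * T => b1 z.1 z.2) ->
  measurable_fun setT (fun z : T * T => b2 z.1 z.2) ->
  jprob P Q (fun y z => b1 y z || b2 y z) <= jprob P Q b1 + jprob P Q b2.
Proof. by move=> m1 m2; exact: prob_or. Qed.

Lemma jprob_ge0 P Q (b : T -> T -> bool) : 0 <= jprob P Q b.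
Proof. exact: prob_ge0. Qed.

Lemma nonneg_conv P Q : nonneg P -> nonneg Q -> nonneg (convolution P Q).
Proof.
move=> P0 Q0; apply/eqP; rewrite eq_le prob_ge0 andbT conv_prob.
rewrite -[leRHS](_ : prob P (fun y : T => y < 0) * prob Q xpredT = 0);
  last by rewrite P0 mul0r.
rewrite -jprob_rect; [|by mevent..]; rewrite -[leLHS]mul1r.
apply: jprob_le_secr => //; [by mevent..|move=> z z0; rewrite mul1r].
by apply: prob_le; [mevent..|move=> y; rewrite andbT; lra].
Qed.

Lemma measurable_shift_event (b : T -> T -> bool) x :
  measurable_fun setT (fun z : T * T => b z.1 z.2) ->
  measurable_fun setT (fun z : T * T => b z.1 (x + z.2)).
Proof.
move=> mb; apply: (measurableT_comp (f := fun z : T * T => b z.1 z.2)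
  (g := fun z : T * T => (z.1, x + z.2))) => //.
by apply/measurable_fun_pairP; split; rewrite /comp/=; mevent.
Qed.

(** Conditioning on the head [x] of the second variable exchanges it with the
    first variable; this replaces symmetry of the law of the summands. *)
Lemma jprob_conv P Q1 Q (b : T -> T -> bool) :
  measurable_fun setT (fun z : T * T => b z.1 z.2) ->
  (jprob P (convolution Q1 Q) b)%:E =
  (\int[Q1]_x (jprob P Q (fun y z => b y (x + z)%R))%:E)%E.
Proof.
move=> mb; rewrite jprob_secr// conv_int; last 2 first.
- exact: measurable_prob_secr.
- by move=> x; rewrite lee_fin prob_ge0.
apply: eq_integral => x _; rewrite jprob_secr//.
exact: measurable_shift_event.
Qed.

Lemma measurable_jprob_shift P Q (b : T -> T -> bool) :
  measurable_fun setT (fun z : T * T => b z.1 z.2) ->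
  measurable_fun setT (fun x : T => (jprob P Q (fun y z => b y (x + z)))%:E).
Proof.
move=> mb; have mh := measurable_prob_secr P mb.
have -> : (fun x : T => (jprob P Q (fun y z => b y (x + z)))%:E) =
    fubini_F Q (fun z : T * T => (prob P (b^~ (z.1 + z.2)))%:E).
  by apply/funext => x; rewrite jprob_secr//; exact: measurable_shift_event.
apply: measurable_fun_fubini_tonelli_F.
  by apply: (measurableT_comp mh); exact: measurable_sum_pair.
by move=> z; rewrite lee_fin prob_ge0.
Qed.

End convolution_facts.

(** * Sums of independent copies *)

Section walk.
Context {R : realType}.
Variable F : realdist R.
Hypothesis F_ge0 : nonneg F.
Local Notation T := (measurableTypeR R).

(** Unlike [convolution_pow], every step including the first is a convolution,
    so that inductions can start from the empty sum. *)
Fixpoint walk n : realdist R :=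
  if n is m.+1 then convolution F (walk m) else \d_(0 : T).

Lemma measurable_sum_event (b : T -> bool) : measurable_fun setT b ->
  measurable_fun setT (fun z : T * T => b (z.1 + z.2)).
Proof.
by move=> mb; apply: (measurableT_comp mb); exact: measurable_sum_pair.
Qed.

Lemma prob_walk1 (b : T -> bool) : measurable_fun setT b ->
  prob (walk 1) b = prob F b.
Proof.
move=> mb; apply: EFin_inj; rewrite conv_prob jprob_secr/=; last first.
  exact: measurable_sum_event.
rewrite integral_dirac//; last first.
  by apply: measurable_prob_secr; exact: measurable_sum_event.
rewrite diracT mul1e; congr (_%:E); congr (prob _ _).
by apply/funext => y; rewrite addr0.
Qed.

Lemma prob_convolution_pow n (b : T -> bool) : measurable_fun setT b ->
  prob (convolution_pow F n.+1) b = prob (walk n.+1) b.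
Proof.
rewrite /convolution_pow iteropS.
elim: n b => [|n IH] b mb; first by rewrite prob_walk1.
rewrite iterS [walk n.+2]/= !conv_prob; apply: EFin_inj.
have mb2 := measurable_sum_event mb.
rewrite !jprob_secl//; apply: eq_integral => y _; rewrite IH//.
exact: (measurable_secl y mb2).
Qed.

Lemma tail_convolution_pow n : tail (convolution_pow F n.+1) = tail (walk n.+1).
Proof.
by apply/funext => x; rewrite !tailE prob_convolution_pow//; mevent.
Qed.

Lemma nonneg_walk n : nonneg (walk n).
Proof.
elim: n => [|n IH] /=; last exact: nonneg_conv.
by rewrite /nonneg /prob/= /dirac indicE memNset//= ltxx.
Qed.

Lemma walk0_itv a c : 0 <= a ->
  prob (walk 0) (fun s : T => (a < s) && (s <= a + c)) = 0.
Proof. by move=> a0; rewrite /prob/= /dirac indicE memNset//= ltNge a0. Qed.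

Definition big_summand n D c a :=
  jprob F (walk n) (fun y z => [&& D <= y, a < y + z & y + z <= a + c]).

Lemma big_summandE n D c a : (big_summand n.+1 D c a)%:E =
  (\int[F]_x (big_summand n D c (a - x))%:E)%E.
Proof.
rewrite /big_summand [walk n.+1]/= jprob_conv; last by mevent.
apply: eq_integral => x _; congr (_%:E); congr (prob _ _).
apply/funext => -[y z] /=; congr (_ && _).
by congr (_ && _); lra.
Qed.

Lemma measurable_big_summand n D c a :
  measurable_fun setT (fun x : T => (big_summand n D c (a - x))%:E).
Proof.
have mb : measurable_fun setT (fun z : T * T =>
  [&& D <= z.1, a < z.1 + z.2 & z.1 + z.2 <= a + c]) by mevent.
have := @measurable_jprob_shift R F (walk n)
  (fun y z => [&& D <= y, a < y + z & y + z <= a + c]) mb.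
congr (measurable_fun _ _).
apply/funext => x; congr (_%:E); congr (prob _ _).
by apply/funext => -[y z] /=; congr (_ && _); congr (_ && _); lra.
Qed.

(** If [n + 1] summands add up to more than [D *+ n.+1], one of them is at
    least [D]; by exchangeability it may be taken to be the head, at the price
    of the factor [n + 1]. In the induction, either the head is at least [D],
    or it is smaller, and then the rest of the walk still exceeds
    [D *+ n.+1]: apply the induction hypothesis to the rest and move its large
    head to the front by [big_summandE]. *)
Lemma walk_jump n D c a : 0 < D -> D *+ n.+1 <= a ->
  prob (walk n.+1) (fun s : T => (a < s) && (s <= a + c)) <=
  big_summand n D c a *+ n.+1.
Proof.
move=> D0; elim: n a => [|n IH] a aD.
  rewrite conv_prob -[leLHS]mul1r mulr1n; apply: jprob_le_secl; [by mevent..| |].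
    by [].
  move=> y; rewrite mul1r; case: (leP D y) => Dy /=.
    by [].
  rewrite (_ : prob _ _ = 0)//.
  transitivity (prob (walk 0) (fun s : T => (a - y < s) && (s <= a - y + c))).
    by congr (prob _ _); apply/funext => z; congr (_ && _); lra.
  by apply: walk0_itv; lra.
rewrite mulrSr conv_prob.
set small := fun y z : T => [&& y < D, a < y + z & y + z <= a + c].
have -> : jprob F (walk n.+1) (fun y z => (a < y + z) && (y + z <= a + c)) =
  jprob F (walk n.+1) small + big_summand n.+1 D c a.
  rewrite -jprob_add; [|by mevent|by mevent|].
    congr (jprob _ _ _); apply/funext => y; apply/funext => z.
    by rewrite /small; case: (ltP y D); rewrite ?orbF.
  by move=> y z /andP[h1 _] /andP[h2 _]; lra.
rewrite lerD2r -lee_fin jprob_secl; last by mevent.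
rewrite -(mulr_natl (big_summand n.+1 D c a) n.+1).
rewrite EFinM [X in (_ * X)%E](big_summandE n D c a).
rewrite -ge0_integralZl; first last.
- by rewrite lee_fin.
- by move=> x _; rewrite lee_fin jprob_ge0.
- exact: measurable_big_summand.
- exact: measurableT.
apply: ge0_le_integral => //.
- by move=> y _; rewrite lee_fin prob_ge0.
- by apply: measurable_prob_secl; mevent.
- by apply: measurable_funeM; exact: measurable_big_summand.
move=> y _; rewrite -EFinM lee_fin mulr_natl.
case: (ltP y D) => yD; last first.
  rewrite prob_false ?mulrn_wge0 ?jprob_ge0// => z.
  by rewrite /small ltNge yD.
apply: le_trans (IH (a - y) _); last by rewrite mulrS in aD; lra.
rewrite le_eqVlt; apply/orP; left; apply/eqP; congr (prob _ _).
by apply/funext => z; rewrite /small yD /=; congr (_ && _); lra.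
Qed.
End walk.

(** * The induction on the number of summands *)

(* Unification would otherwise unfold walks down to integrals. *)
#[local] Opaque prob jprob tail.

Section asymptotics.
Context {R : realType}.
Variables (gamma : R) (F : realdist R).
Hypothesis gamma_gt0 : 0 < gamma.
Hypothesis F_ge0 : nonneg F.
Hypothesis F_pos : forall x, 0 < tail F x.
Hypothesis F_mass : exists2 b, 0 <= b & tail F b < 1.
Hypothesis F_OL : forall t, 0 < t ->
  exists2 C, 0 < C & forall x, tail F (x - t) <= C * tail F x.
Hypothesis F_decay : forall t x, 0 < t -> t <= x ->
  expR (gamma * t) * tail F x <= tail F (x - t).
(* This is invariant under exponential tilting, because the
   exponential factors on both sides agree. *)
Hypothesis F_prod : forall e, 0 < e -> exists U, forall B, exists w0,
  forall w u, w0 <= w -> U <= u <= B -> tail F u * tail F w <= e * tail F (w + u).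
Local Notation T := (measurableTypeR R).

(** The lower limit of [tail V (x - t) / tail V x] is at least
    [expR (gamma * t)], freed of quotients and limits. *)
Definition exp_shift (V : realdist R) := forall t a, 0 < t -> a < expR (gamma * t) ->
  exists x0, forall x, x0 <= x -> a * tail V x <= tail V (x - t).

Lemma tail_walk n x :
  tail (walk F n.+1) x = jprob F (walk F n) (fun y z => x < y + z).
Proof. by rewrite tailE conv_prob. Qed.

Lemma tail_walk_OL n t : 0 < t -> exists2 C, 0 < C &
  forall x, tail (walk F n.+1) (x - t) <= C * tail (walk F n.+1) x.
Proof.
move=> /F_OL[C C0 FC]; exists C => // x.
rewrite !tail_walk mulrC -ler_pdivrMr// mulrC.
apply: jprob_le_secr; [by mevent|by mevent|by rewrite invr_ge0 ltW| |].
  exact: nonneg_walk.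
move=> z _; rewrite mulrC ler_pdivrMr// mulrC.
by rewrite !prob_gtDr addrAC; exact: FC.
Qed.

Lemma tail_walk_gt0 n x : 0 < tail (walk F n.+1) x.
Proof.
apply: lt_le_trans (F_pos x) _; rewrite tail_walk tailE.
rewrite -[leLHS]mulr1 -(prob_nonneg (nonneg_walk F_ge0 n)).
rewrite -jprob_rect; [|by mevent..].
by apply: jprob_le; [mevent..|move=> y z /andP[]; lra].
Qed.

(** A fresh summand in [[0, b]] keeps the sum above [x] and lifts the walk by at
    most [b]. *)
Lemma walk_head n b v x :
  prob F (fun y => 0 <= y <= b) *
    jprob F (walk F n) (fun y z => (z <= v - b) && (x < y + z)) <=
  jprob F (walk F n.+1) (fun y z => (z <= v) && (x < y + z)).
Proof.
apply: jprob_le_secl; [by mevent..|exact: prob_ge0|].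
move=> y; rewrite conv_prob -jprob_rect; [|by mevent..].
by apply: jprob_le; [mevent..|move=> y' z /andP[/andP[? ?] /andP[? ?]]; lra].
Qed.

(** The order of the choices is what makes this work: [F_prod] provides [U]
    from [e] and from a constant [C0] that does not involve [U], and [B] is
    then taken large with respect to [U]. *)
Lemma both_large_negligible n (e B0 : R) : exp_shift (walk F n.+1) -> 0 < e ->
  exists2 B, B0 <= B & exists x0, forall x, x0 <= x ->
    tail (walk F n.+1) B * tail F (x - B) <= e * tail (walk F n.+2) x.
Proof.
move=> shiftG e0; have [b b0 Fb] := F_mass.
set p := prob F (fun y => 0 <= y <= b).
have p0 : 0 < p.
  have : prob F (fun y : T => (0 <= y <= b) || (b < y)) = 1.
    rewrite -(prob_nonneg F_ge0); congr (prob _ _); apply/funext => y.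
    by case: (ltP b y) => yb; rewrite ?orbT ?orbF ?andbT//; lra.
  rewrite prob_add; [rewrite -tailE -/p; lra|by mevent..|].
  by move=> y /andP[? ?]; lra.
(* With this [c] the shift by [c] at least halves the tail of the walk. *)
pose c := 2 / gamma.
have c0 : 0 < c by rewrite divr_gt0.
have ec : 2 < expR (gamma * c).
  have := expR_ge1Dx (gamma * c); rewrite /c mulrCA mulfV ?gt_eqF// mulr1; lra.
have [x1 Gx1] := shiftG _ _ c0 ec.
pose C0 := 2 * n.+1%:R / p.
have C00 : 0 < C0 by rewrite divr_gt0// mulr_gt0.
have [|U FU] := F_prod (e := e / C0); first by rewrite divr_gt0.
(* A walk in ]B, B + c] that loses a summand of size [D] and gains one of size
   at most [b] falls below [B - U]. *)
pose D := Num.max 1 (c + U + b).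
have D1 : 1 <= D by rewrite le_max lexx.
have DU : c + U + b <= D by rewrite le_max lexx orbT.
pose B := Num.max B0 (Num.max x1 (D *+ n.+1)).
have [BB0 Bx1 BD] : [/\ B0 <= B, x1 <= B & D *+ n.+1 <= B].
  by rewrite !le_max !lexx !orbT.
exists B => //; have [w0 Fw0] := FU B.
exists (w0 + B) => x xw.
set K := jprob F (walk F n.+1) (fun y z => (z <= B - U) && (B < y + z)).
have GK : tail (walk F n.+1) B <= C0 * K.
  set J := prob (walk F n.+1) (fun s : T => (B < s) && (s <= B + c)).
  have GJ : tail (walk F n.+1) B <= 2 * J.
    have : tail (walk F n.+1) B = J + tail (walk F n.+1) (B + c).
      rewrite !tailE -prob_add; [|by mevent..|by move=> s /andP[? ?]; lra].
      congr (prob _ _); apply/funext => s.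
      by case: (leP s (B + c)) => sB; rewrite ?andbT ?orbF ?andbF//=; lra.
    have := Gx1 (B + c); rewrite addrK => /(_ ltac:(lra)).
    move: (tail _ _) (tail _ _) => u v; clear; lra.
  have JK : p * J <= n.+1%:R * K.
    apply: (@le_trans _ _ (n.+1%:R * (p * big_summand F n D c B))).
      rewrite mulrCA ler_pM2l// mulr_natl.
      by apply: walk_jump => //; lra.
    rewrite ler_pM2l// /K.
    apply: le_trans (walk_head n b (B - U) B); rewrite ler_pM2l//.
    by apply: jprob_le; [mevent..|move=> y z /and3P[? ? ?]; lra].
  rewrite (le_trans GJ)// /C0 -2!mulrA ler_pM2l// mulrCA.
  by rewrite mulrC ler_pdivlMr//= mulrC (le_trans JK)// mulrC.
have KH : tail F (x - B) * K <= e / C0 * tail (walk F n.+2) x.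
  have d0 : 0 < e / C0 by rewrite divr_gt0.
  rewrite -ler_pdivrMl// mulrA tail_walk; apply: jprob_le_secr; [by mevent..| | |].
  - by rewrite mulr_ge0 ?tail_ge0// invr_ge0 ltW.
  - exact: nonneg_walk.
  move=> z z0; rewrite -mulrA ler_pdivrMl//.
  case: (leP z (B - U)) => zB /=; last first.
    by rewrite prob_false// mulr0; apply: mulr_ge0; [exact: ltW|exact: prob_ge0].
  have := Fw0 (x - B) (B - z) ltac:(lra) ltac:(lra).
  by rewrite !prob_gtDr addrA subrK mulrC.
rewrite mulrC; apply: le_trans (ler_wpM2l (tail_ge0 _ _) GK) _.
rewrite mulrCA; apply: le_trans (ler_wpM2l (ltW C00) KH) _.
have eC : C0 * (e / C0) = e by rewrite mulrC divfK// gt_eqF.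
by rewrite mulrA eC lexx.
Qed.

(** Of the three events covering [y + z > x], the first two remain disjoint
    when [x] is replaced by [x - t], because the bounds [x - t - B] and [B] add
    up to [x - t]. *)
Lemma walk_exp_shift n : exp_shift (walk F n.+1).
Proof.
elim: n => [|n IH] t a t0 at_.
  exists t => x tx; rewrite !tailE !prob_walk1 -?tailE; [|by mevent..].
  apply: le_trans (F_decay t0 tx).
  by rewrite ler_wpM2r ?tail_ge0// ltW.
have [a0|a0] := leP a 0.
  exists 0 => x _; apply: (@le_trans _ _ 0); last exact: tail_ge0.
  by rewrite mulr_le0_ge0 ?tail_ge0.
(* The room between [a] and [a'] absorbs the event where both are large. *)
pose a' := (a + expR (gamma * t)) / 2.
have aa' : a < a' by rewrite /a'; lra.
have a't : a' < expR (gamma * t) by rewrite /a'; lra.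
have a'0 : 0 < a' by lra.
have [A0 GA0] := IH _ _ t0 a't.
have [C C0 FC] := F_OL t0.
pose e := (1 - a / a') / C.
have e0 : 0 < e by rewrite divr_gt0// subr_gt0 ltr_pdivrMr// mul1r.
have [B BA0 [x0 Bx0]] := @both_large_negligible n e A0 IH e0.
exists (Num.max x0 (t + B)) => x; rewrite ge_max => /andP[xx0 xB].
set G := walk F n.+1.
pose big_z s := jprob F G (fun y z => (y <= x - t - B) && (s < y + z)).
pose small_z s := jprob F G (fun y z => (z <= B) && (s < y + z)).
have Hx : tail (walk F n.+2) x <=
    big_z x + small_z x + tail F (x - t - B) * tail G B.
  rewrite tail_walk !tailE -jprob_rect; [|by mevent..].
  apply: (@le_trans _ _ (jprob F G (fun y z =>
      [|| (y <= x - t - B) && (x < y + z), (z <= B) && (x < y + z) |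
          (x - t - B < y) && (B < z)]))).
    apply: jprob_le; [by mevent..|move=> y z -> /=].
    by rewrite !andbT; case: (leP y) => //= _; case: (leP z).
  rewrite -[leRHS]addrA; apply: le_trans (@jprob_or R F G
    (fun y z => (y <= x - t - B) && (x < y + z)) (fun y z =>
      (z <= B) && (x < y + z) || (x - t - B < y) && (B < z)) _ _) _.
  - by mevent.
  - by mevent.
  by rewrite lerD2l; apply: jprob_or; mevent.
have bigx : a' * big_z x <= big_z (x - t).
  apply: jprob_le_secl; [by mevent..|exact: ltW|move=> y].
  case: (leP y (x - t - B)) => yB /=; last first.
    by rewrite prob_false// mulr0.
  by rewrite !prob_gtDl addrAC; apply: GA0; lra.
have smallx : a' * small_z x <= small_z (x - t).
  apply: jprob_le_secr; [by mevent..|exact: ltW|exact: nonneg_walk|move=> z z0].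
  case: (leP z B) => zB /=; last first.
    by rewrite prob_false// mulr0.
  have tz : t <= x - z by rewrite lerBrDr (le_trans _ xB)// lerD2l.
  rewrite !prob_gtDr addrAC; apply: le_trans (F_decay t0 tz).
  by apply: ler_wpM2r; [exact: tail_ge0|exact: ltW].
have Hxt : big_z (x - t) + small_z (x - t) <= tail (walk F n.+2) (x - t).
  rewrite tail_walk -jprob_add; [|by mevent..|].
    apply: jprob_le; [by mevent..|].
    by move=> y z /orP[] /andP[].
  move=> y z /andP[yB _] /andP[zB]; apply/negP; rewrite -leNgt.
  by rewrite (le_trans (lerD yB zB))// subrK.
have two : tail F (x - t - B) * tail G B <= (1 - a / a') * tail (walk F n.+2) x.
  rewrite mulrC addrAC.
  apply: le_trans (ler_wpM2l (tail_ge0 _ _) (FC (x - B))) _.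
  rewrite mulrCA; apply: le_trans (ler_wpM2l (ltW C0) (Bx0 x xx0)) _.
  have eC : C * e = 1 - a / a' by rewrite mulrC divfK// gt_eqF.
  by rewrite mulrA eC lexx.
have -> : a = a' * (a / a') by rewrite mulrC divfK// gt_eqF.
apply: le_trans Hxt; apply: le_trans (lerD bigx smallx).
rewrite -[leRHS]mulrDr -[leLHS]mulrA (ler_pM2l a'0).
rewrite -[a / a'](subKr 1) mulrBl mul1r lerBlDr.
by apply: le_trans Hx _; rewrite lerD2l.
Qed.

End asymptotics.

(** * From limits of tail quotients to inequalities and back *)

Section tail_ratios.
Context {R : realType}.
Implicit Type V : realdist R.

Lemma Cstar_lt_bound V t c : (forall x, 0 < tail V x) -> (Cstar V t < c%:E)%E ->
  exists x0, forall x, x0 <= x -> tail V (x - t) <= c * tail V x.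
Proof.
move=> V0; rewrite /Cstar limf_esupE => /ereal_inf_lt[_ [A [M [_ MA]] <-]] supA.
exists (M + 1) => x Mx; rewrite -ler_pdivrMr// -lee_fin.
apply: le_trans (ltW supA); apply: ereal_sup_ubound.
by exists x => //; apply: MA; rewrite (lt_le_trans _ Mx)// ltrDl.
Qed.

(** Below the threshold where the upper limit takes effect, the tail is bounded
    away from 0, so a single constant serves on the whole line. *)
Lemma class_OL_bound V t : class_OL V -> 0 < t ->
  exists2 C, 0 < C & forall x, tail V (x - t) <= C * tail V x.
Proof.
move=> [V0 VOL] t0.
have [c Vc] : exists c : R, (Cstar V t < c%:E)%E.
  case: (Cstar V t) (VOL _ t0) => [r _|//|_]; last by exists 0; exact: ltNyr.
  by exists (r + 1); rewrite lte_fin ltrDl.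
have [x0 Vx0] := Cstar_lt_bound V0 Vc.
have i0 : 0 < (tail V x0)^-1 by rewrite invr_gt0.
exists (Num.max c (tail V x0)^-1) => [|x]; first by rewrite lt_max i0 orbT.
have [x0x|/ltW xx0] := leP x0 x.
  apply: le_trans (Vx0 x x0x) _.
  by rewrite ler_wpM2r ?tail_ge0// le_max lexx.
apply: le_trans (tail_le1 V _) _.
apply: (@le_trans _ _ ((tail V x0)^-1 * tail V x)).
  by rewrite mulrC ler_pdivlMr// mul1r tail_le.
by rewrite ler_wpM2r ?tail_ge0// le_max lexx orbT.
Qed.

Lemma bound_class_OL V : (forall x, 0 < tail V x) ->
  (forall t, 0 < t -> exists2 C, 0 < C & forall x, tail V (x - t) <= C * tail V x) ->
  class_OL V.
Proof.
move=> V0 VC; split => // t t0; have [C C0 {}VC] := VC _ t0.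
apply: (@le_lt_trans _ _ C%:E); last exact: ltry.
rewrite /Cstar limf_esupE; apply: ge_ereal_inf.
exists (ereal_sup [set (tail V (x - t) / tail V x)%:E | x in [set: R]]).
  by exists setT => //; exact: filterT.
by apply: ge_ereal_sup => _ [x _ <-]; rewrite lee_fin ler_pdivrMr.
Qed.

Lemma exp_shift_einf gamma V t : (forall x, 0 < tail V x) ->
  exp_shift gamma V -> 0 < t ->
  ((expR (gamma * t))%:E <=
    limf_einf (fun x : R => (tail V (x - t) / tail V x)%:E) +oo%R)%E.
Proof.
move=> V0 Vs t0; apply/lee_subgt0Pr => e e0; rewrite limf_einfE.
have [|x0 Vx0] := Vs t (expR (gamma * t) - e) t0; first by rewrite ltrBlDr ltrDl.
apply: le_ereal_sup_tmp.
exists (ereal_inf [set (tail V (x - t) / tail V x)%:E | x in [set x | x0 <= x]]).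
  by exists [set x | x0 <= x] => //; apply: nbhs_pinfty_ge; exact: num_real.
apply: le_ereal_inf_tmp => _ [x /= x0x <-].
by rewrite -EFinB lee_fin ler_pdivlMr// Vx0.
Qed.

(** The condition provides a threshold for each single shift [v]; passing from
    [u] in [[v - 1, v]] to [v] costs only the constant [C] of the unit shift,
    so finitely many thresholds cover a bounded interval of shifts. *)
Lemma tail_prod_bound V : class_OL V ->
  ((tail V x)%:E * Cstar V x)%E @[x --> +oo%R] --> 0%E ->
  forall e, 0 < e -> exists U, forall B, exists w0,
    forall w u, w0 <= w -> U <= u <= B ->
    tail V u * tail V w <= e * tail V (w + u).
Proof.
move=> VOL Vlim e e0; have V0 := VOL.1.
have [C C0 VC] := class_OL_bound VOL ltr01.
have eC0 : 0 < e / C by rewrite divr_gt0.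
have : nbhs 0%E [set y : \bar R | (y < (e / C)%:E)%E].
  by apply: open_ereal_lt'; rewrite lte_fin.
move=> /Vlim [U0 [_ VU]].
have pt u : U0 < u -> exists w0, forall w, w0 <= w ->
    tail V u * tail V w <= e / C * tail V (w + u).
  move=> /VU/=; rewrite -lte_pdivlMl// -EFinM => /(Cstar_lt_bound V0)[x0 Vx0].
  exists (x0 - u) => w x0w.
  have := Vx0 (w + u); rewrite addrK -lerBlDr => /(_ x0w).
  by rewrite -[X in _ <= X -> _]mulrA ler_pdivlMl.
have pt1 v : U0 < v -> exists w0, forall w u, w0 <= w -> v - 1 <= u <= v ->
    tail V u * tail V w <= e * tail V (w + u).
  move=> /pt[w0 w0P]; exists w0 => w u /w0P {}w0P /andP[vu uv].
  apply: (@le_trans _ _ (C * (tail V v * tail V w))).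
    rewrite mulrA; apply: ler_wpM2r; first exact: tail_ge0.
    by apply: le_trans (VC v); exact: tail_le.
  apply: (@le_trans _ _ (C * (e / C * tail V (w + v)))).
    by rewrite ler_pM2l.
  rewrite mulrA (mulrC C) divfK ?gt_eqF//.
  by apply: ler_wpM2l; [exact: ltW|apply: tail_le; rewrite lerD2l].
exists (U0 + 1) => B.
have [m Bm] : exists m : nat, B <= U0 + 1 + m%:R.
  exists (Num.bound `|B - (U0 + 1)|); rewrite -lerBlDl.
  by apply: le_trans (ler_norm _) (ltW (archi_boundP _)).
suff [w0 w0P] : exists w0, forall w u, w0 <= w -> U0 + 1 <= u <= U0 + 1 + m%:R ->
    tail V u * tail V w <= e * tail V (w + u).
  exists w0 => w u w0w /andP[Uu uB]; apply: w0P => //.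
  by rewrite Uu (le_trans uB).
elim: m {Bm} => [|m [w1 w1P]].
  have [|w0 w0P] := pt1 (U0 + 1 + 1); first by rewrite -addrA ltrDl.
  exists w0 => w u w0w /andP[Uu uU]; apply: w0P => //; rewrite addrK Uu /=.
  by rewrite (le_trans uU)// lerD2l.
have [|w2 w2P] := pt1 (U0 + 1 + m.+1%:R); first by rewrite -addrA ltrDl.
exists (Num.max w1 w2) => w u; rewrite ge_max => /andP[w1w w2w] /andP[Uu um].
have [uM|Mu] := leP u (U0 + 1 + m%:R); first by apply: w1P => //; rewrite Uu.
by apply: w2P => //; rewrite um andbT -addrA -natr1 -!addrA subrr addr0 addrA ltW.
Qed.

(** The open half-line of negative reals is covered by countably many closed
    half-lines, on each of which the tail being 1 leaves no mass. *)
Lemma nonneg_of_tail V : (forall x, x < 0 -> tail V x = 1) -> nonneg V.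
Proof.
move=> V1; apply: EFin_inj; rewrite probE; last by mevent.
apply/negligibleP; first by apply: measurable_event; mevent.
have -> : [set x : measurableTypeR R | x < 0] =
    \bigcup_k [set x | x <= - k.+1%:R^-1].
  apply/seteqP; split => [x /= /ltr_add_invr[k xk]|x [k _ /=] xk].
    by exists k => //=; rewrite ltW// -subr_lt0 opprK.
  by apply: le_lt_trans xk _; rewrite oppr_lt0 invr_gt0.
apply: negligible_bigcup => k.
apply/negligibleP; first by apply: measurable_event; mevent.
set b := - _; have b0 : b < 0 by rewrite oppr_lt0 invr_gt0.
have mb : measurable_fun setT (fun x : measurableTypeR R => x <= b) by mevent.
suff p0 : prob V (fun x => x <= b) = 0.
  transitivity (prob V (fun x => x <= b))%:E; first by rewrite probE.
  by rewrite p0.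
have : prob V (fun x => (x <= b) || (b < x)) = 1.
  by apply: prob_true => y; case: leP.
rewrite prob_add//; [|by mevent|by move=> x xb; rewrite ltNge xb].
by rewrite -tailE V1// => /(canRL (addrK _)) ->; rewrite subrr.
Qed.
End tail_ratios.

(** * The distribution with the exponentially tilted tail *)

Unset Implicit Arguments.

Theorem proposition6p2 (R : realType) (gamma : R) (F0 F : realdist R)
  (gamma_gt0 : 0 < gamma)
  (F0_supp : F0 `]-oo, 0[%classic = 0%E)
  (F_tail : forall x : R,
     tail F x = if x < 0 then 1 else expR (- (gamma * x)) * tail F0 x)
  (F0_heavy : heavy_tailed F0)
  (F0_OL : class_OL F0)
  (F0_lim : ((tail F0 x)%:E * Cstar F0 x)%E @[x --> +oo%R] --> 0%E) :
  forall k : nat, (1 <= k)%N ->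
    class_OL (convolution_pow F k) /\
    forall t : R, 0 < t ->
      ((expR (gamma * t))%:E <=
       limf_einf (fun x : R => (tail (convolution_pow F k) (x - t)
                                / tail (convolution_pow F k) x)%:E) +oo%R)%E.
Proof.
have F0_pos := F0_OL.1.
have tailF x : 0 <= x -> tail F x = expR (- (gamma * x)) * tail F0 x.
  by move=> x0; rewrite F_tail ltNge x0.
have Fnonneg : nonneg F.
  by apply: nonneg_of_tail => x x0; rewrite F_tail x0.
have Fpos x : 0 < tail F x.
  by rewrite F_tail; case: ifP => // _; rewrite mulr_gt0 ?expR_gt0.
have Fmass : exists2 b, 0 <= b & tail F b < 1.
  exists 1; rewrite ?ler01// tailF// mulr1.
  apply: (@le_lt_trans _ _ (expR (- gamma))); last by rewrite expR_lt1 oppr_lt0.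
  by rewrite -[leRHS]mulr1 ler_pM2l ?expR_gt0// tail_le1.
have tail_shift x t : 0 < t -> t <= x ->
    tail F (x - t) = expR (gamma * t) * (expR (- (gamma * x)) * tail F0 (x - t)).
  move=> t0 tx; rewrite tailF ?subr_ge0// mulrA -expRD.
  by congr (expR _ * _); rewrite mulrBr opprB.
have F_bound t : 0 < t -> exists2 C, 0 < C &
    forall x, tail F (x - t) <= C * tail F x.
  move=> t0; have [C C0 F0C] := class_OL_bound F0_OL t0.
  have A0 : 0 < expR (gamma * t) * C by rewrite mulr_gt0 ?expR_gt0.
  have B0 : 0 < (tail F t)^-1 by rewrite invr_gt0.
  exists (Num.max (expR (gamma * t) * C) (tail F t)^-1) => [|x].
    by rewrite lt_max A0.
  have [tx|/ltW xt] := leP t x.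
    apply: (@le_trans _ _ (expR (gamma * t) * C * tail F x)).
      rewrite tail_shift// -mulrA ler_pM2l ?expR_gt0// tailF; last first.
        by rewrite (le_trans _ tx)// ltW.
      by rewrite mulrCA ler_pM2l ?expR_gt0.
    by apply: ler_wpM2r; [exact: tail_ge0|rewrite le_max lexx].
  apply: (@le_trans _ _ ((tail F t)^-1 * tail F x)).
    rewrite mulrC ler_pdivlMr// (le_trans _ (tail_le F xt))//.
    by rewrite ler_piMl ?tail_ge0 ?tail_le1.
  by apply: ler_wpM2r; [exact: tail_ge0|rewrite le_max lexx orbT].
have Fdecay t x : 0 < t -> t <= x ->
    expR (gamma * t) * tail F x <= tail F (x - t).
  move=> t0 tx; rewrite tail_shift// ler_pM2l ?expR_gt0// tailF; last first.
    by rewrite (le_trans _ tx)// ltW.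
  by rewrite ler_pM2l ?expR_gt0// tail_le// gerBl ltW.
have Fprod e : 0 < e -> exists U, forall B, exists w0, forall w u, w0 <= w ->
    U <= u <= B -> tail F u * tail F w <= e * tail F (w + u).
  move=> /(tail_prod_bound F0_OL F0_lim)[U UP]; exists (Num.max 0 U) => B.
  have [w0 w0P] := UP B; exists (Num.max 0 w0) => w u.
  rewrite !ge_max => /andP[w_ge0 w0w] /andP[/andP[u_ge0 Uu] uB].
  rewrite !tailF ?addr_ge0// mulrACA [leRHS]mulrCA.
  rewrite -expRD -opprD -mulrDr (addrC u) ler_pM2l ?expR_gt0//.
  by apply: w0P => //; rewrite Uu.
case=> // n _.
have pos x : 0 < tail (convolution_pow F n.+1) x.
  by rewrite tail_convolution_pow; exact: tail_walk_gt0.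
split => [|t t0].
  apply: bound_class_OL => // t t0; rewrite tail_convolution_pow.
  exact: tail_walk_OL.
apply: exp_shift_einf => //.
by rewrite /exp_shift tail_convolution_pow; exact: walk_exp_shift.
Qed.
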